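(* Let $Z\subset S^1$ with $|Z|\ge4$ be such that no point of $Z$ is a limit point of $Z$ and each limit point of $Z$ is a limit of points of $Z$ from both sides, and let $T$ be a triangulation of $Z$. For every $e\ne f$ in $\overline Z$ such that $X_{e,f}\ne\varnothing$, with $Y:=T\cap\{e,f\}\subset\{e,f\}\cong(0,1)$, there exists an isomorphism of abelian groups $$\psi:K_0^{\mathrm{split}}(\mathscr{T}(T))^*_{e,f}\xrightarrow{\ \cong\ }\mathbb{Z}^{(Y_{\mathrm{ext}})}_0$$ which restricts to a bijection $$X_{e,f}\xrightarrow{\ \cong\ }\Delta^+(Y_{\mathrm{ext}}).$$
   Context: **Combinatorics.** $S^1$ is oriented counterclockwise, inequalities refer to the counterclockwise cyclic order; $\overline Z$ is the closure of $Z$ in $S^1$; for $z\in Z$, $z^\pm$ are its immediate counterclockwise successor ($+$) and predecessor ($-$) in $Z$. A diagonal of $Z$ is a set $\{z_1,z_2\}$ of two distinct non-neighbouring elements of $Z$. Pairs of distinct points of $\overline Z$ are viewed as open straight segments; $\{e,f\}$ crosses a diagonal $t=\{t_0,t_1\}$ if $e<t_0<f<t_1<e$ or $e<t_1<f<t_0<e$. A limit point $y$ of $Z$ is surrounded by a fountain of $T$ if for some $z\in Z$, $T$ contains diagonals $\{z_n,z\},\{z_n',z\}$ ($n\in\mathbb N$) with $z_n\to y$ and $z'_n\to y$ from the two different sides; it is surrounded by a leapfrog of $T$ if $T$ contains diagonals $\{z_n,z_{n+1}\}$ ($n\in\mathbb N$) with $z_{2n}$ and $z_{2n+1}$ converging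 to $y$ from the two different sides. A triangulation of $Z$ is a maximal set $T$ of pairwise noncrossing diagonals such that each limit point of $Z$ is surrounded by a fountain or a leapfrog of $T$. $Y=T\cap\{e,f\}$ is the set of points of the open segment $\{e,f\}$ (identified with $(0,1)$, $e$ corresponding to $0$) in which it meets diagonals in $T$, with the induced total order. **Vectors.** $K_0^{\mathrm{split}}(\mathscr{T}(T))$ is the free abelian group on $[t]$, $t\in T$ (the split Grothendieck group of the cluster tilting subcategory $\mathscr{T}(T)=\mathrm{add}\,T$ of the Igusa--Todorov cluster category $\mathscr{C}(Z)$, whose indecomposable objects are indexed by the diagonals of $Z$), and $K_0^{\mathrm{split}}(\mathscr{T}(T))^*=\mathrm{Hom}(K_0^{\mathrm{split}}(\mathscr{T}(T)),\mathbb{Z})$. For $e\ne f$ in $\overline Z$, $\dim_{\mathscr{T}(T)}(\{e,f\})\in K_0^{\mathrm{split}}(\mathscr{T}(T))^*$ takes the value $1$ on $[t]$ if $\{e,f\}$ crosses $t$ and $0$ otherwise. The support of $c$ is $\mathrm{supp}\,c=\{t\in T\mid\langle c,[t]\rangle\neq0\}$. Let $D_{\mathscr{T}(T)}=\{\dim_{\mathscr{T}(T)}(\{a,b\})\mid a\neq b\text{ in }Z\}\setminus\{0\}$; this set equals the set $C^+_{\mathscr{T}(T)}(\mathscr{C}(Z))$ of positive $c$-vectors of $\mathscr{C}(Z)$ with respect to $\mathscr{T}(T)$. Then $X_{e,f}=\{d\in D_{\mathscr{T}(T)}\mid\mathrm{supp}\,d\subseteq\mathrm{supp}\,\dim_{\mathscr{T}(T)}(\{e,f\})\}$,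 and $K_0^{\mathrm{split}}(\mathscr{T}(T))^*_{e,f}$ is the subgroup of $K_0^{\mathrm{split}}(\mathscr{T}(T))^*$ spanned by $X_{e,f}$. **Roots.** For a totally ordered set $Y$, $Y_{\mathrm{ext}}=Y\sqcup\{-\infty\}$ with $-\infty<y$ for all $y\in Y$ if $Y$ has a least element, and $Y_{\mathrm{ext}}=Y$ otherwise. For a set $Y$, $\mathbb{Z}^{(Y)}=\bigoplus_{y\in Y}\mathbb{Z}\epsilon_y$ and $\mathbb{Z}^{(Y)}_0=\mathrm{Span}_{\mathbb Z}\{\epsilon_y-\epsilon_{y'}\mid y\ne y'\in Y\}$. For an at most countable totally ordered set $Y$, $\Delta^+(Y)=\{\epsilon_y-\epsilon_{y'}\mid y>y'\in Y\}$; if $Y$ is infinite this is the set of roots $\Delta^+_{\mathfrak{sl}_\infty}(Y)$ of the Borel subalgebra of $\mathfrak{sl}_\infty$ corresponding to $Y$, and if $|Y|=n$ it is the set $\Delta^+_{\mathfrak{sl}_n}$ of positive roots of $\mathfrak{sl}_n$. *)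

(* Defs.v *)
From HB Require Import structures.
From mathcomp Require Import all_boot all_order all_algebra.
From mathcomp Require Import freeg.
From mathcomp Require Import all_classical all_reals all_analysis.

Set Implicit Arguments.
Unset Strict Implicit.
Unset Printing Implicit Defensive.

Import Order.TTheory GRing.Theory Num.Theory.
Import numFieldNormedType.Exports.

Local Open Scope classical_set_scope.
Local Open Scope ring_scope.

Section Hom.
Variables U V : zmodType.

Definition additive_pred : {pred U -> V} :=
  fun f => `[< {morph f : x y / x + y} >].

Fact additive_pred_closed : zmod_closed additive_pred.
Proof.
split=> [|f g /asboolP fD /asboolP gD]; apply/asboolP => x y.
  by rewrite /GRing.zero /= addr0.
have E w : (f - g) w = f w - g w by [].
by rewrite !E fD gD opprD addrACA.
Qed.

HB.instance Definition _ :=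
  GRing.isZmodClosed.Build (U -> V) additive_pred additive_pred_closed.

(* The library type {additive U -> V} carries no group structure. *)
Record Hom := MkHom { hom_fun :> U -> V ; _ : hom_fun \in additive_pred }.

HB.instance Definition _ := [isSub for hom_fun].
HB.instance Definition _ := [Choice of Hom by <:].
HB.instance Definition _ := [SubChoice_isSubZmodule of Hom by <:].

End Hom.

Section Subgroups.

Definition is_subgroup (V : zmodType) (G : set V) : Prop :=
  G 0 /\ forall u v, G u -> G v -> G (u - v).

Definition zspan (V : zmodType) (X : set V) : set V := smallest (@is_subgroup V) X.

(* [psi] is only meaningful on [A]; its values elsewhere are irrelevant. *)
Definition zmod_iso (V W : zmodType) (A : set V) (B : set W) (psi : V -> W) : Prop :=
  (forall u v, A u -> A v -> psi (u + v) = psi u + psi v) /\ set_bij A B psi.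

End Subgroups.

Definition free_group (K : choiceType) (Y : set K) : zmodType := {freeg Y}.

Section Circle.
Variable R : realType.
Local Notation point := (R * R)%type.
Implicit Types (Z : set point) (T : set (set point)) (y e f : point).

Definition circle : set point := [set p | p.1 ^+ 2 + p.2 ^+ 2 = 1].

Definition cis (x : R) : point := (cos x, sin x).

(* [ccw [:: a1; ...; an]] is  a1 < a2 < ... < an < a1  in the
   counterclockwise cyclic order: the points are met in this order within
   less than one full turn. *)
Definition ccw (s : seq point) : Prop :=
  exists u : seq R, [/\ s = [seq cis x | x <- u],
                        sorted <%R u & last 0 u < head 0 u + 2 * pi].

(* Convergence to y along the counterclockwise (after) and the clockwise
   (before) side of y. *)
Definition cvg_after (z : nat -> point) y : Prop :=
  exists (x : R) (u : nat -> R), [/\ y = cis x, (forall n, z n = cis (u n)) &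
    u @ \oo --> x^'+].

Definition cvg_before (z : nat -> point) y : Prop :=
  exists (x : R) (u : nat -> R), [/\ y = cis x, (forall n, z n = cis (u n)) &
    u @ \oo --> x^'-].

Definition two_sided_limit Z y : Prop :=
  (exists z, (forall n, Z (z n)) /\ cvg_after z y) /\
  (exists z, (forall n, Z (z n)) /\ cvg_before z y).

Definition is_succ Z (z w : point) : Prop :=
  [/\ Z z, Z w, z <> w & forall x, Z x -> ~ ccw [:: z; x; w]].

Definition diagonal Z : set (set point) :=
  [set t | exists z1 z2, [/\ Z z1 /\ Z z2, z1 <> z2,
    ~ is_succ Z z1 z2, ~ is_succ Z z2 z1 & t = [set z1; z2]]].

Definition crosses e f (t : set point) : Prop :=
  exists t0 t1, t = [set t0; t1] /\
    (ccw [:: e; t0; f; t1] \/ ccw [:: e; t1; f; t0]).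

Definition noncrossing T : Prop :=
  forall e f t, T [set e; f] -> T t -> ~ crosses e f t.

Definition fountain Z T y : Prop :=
  exists (z : point) (u v : nat -> point),
    [/\ Z z, forall n, T [set u n; z] /\ T [set v n; z],
        cvg_after u y & cvg_before v y].

Definition leapfrog T y : Prop :=
  exists z : nat -> point, (forall n, T [set z n; z n.+1]) /\
    ((cvg_after (fun n => z n.*2) y /\ cvg_before (fun n => z n.*2.+1) y) \/
     (cvg_before (fun n => z n.*2) y /\ cvg_after (fun n => z n.*2.+1) y)).

Definition triangulation Z T : Prop :=
  [/\ T `<=` diagonal Z,
      noncrossing T,
      (forall T', T' `<=` diagonal Z -> noncrossing T' -> T `<=` T' -> T' = T) &
      forall y, limit_point Z y -> fountain Z T y \/ leapfrog T y].

Definition segment_point e f (s : R) : point :=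
  (line_path e.1 f.1 s, line_path e.2 f.2 s).

Definition open_segment e f : set point := segment_point e f @` `]0, 1[.

(* T cap {e,f}, in the coordinate that sends e to 0 and f to 1. *)
Definition trace T e f : set R :=
  [set s | 0 < s < 1 /\ exists a b,
    T [set a; b] /\ open_segment a b (segment_point e f s)].

Definition K0split T : zmodType := free_group T.

Definition K0split_dual T : zmodType := Hom (K0split T) int.

Unset Implicit Arguments.

Definition dim_fun T e f : K0split T -> int :=
  fglift (fun t : T => (`[< crosses e f (\val t) >]%:R : int^o)).

Fact dim_fun_additive T e f : dim_fun T e f \in @additive_pred (K0split T) int.
Proof.
apply/asboolP => x y.
have B := @lift_is_additive int (set_type T) int^o
  (fun t : T => (`[< crosses e f (\val t) >]%:R : int^o)).
rewrite /dim_fun -{1}[y]opprK B; congr (_ + _).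
by rewrite -[- y]sub0r B -[X in fglift _ X](subrr x) B subrr sub0r opprK.
Qed.

Definition dim_vector T e f : K0split_dual T := MkHom (dim_fun_additive T e f).

Fact dim_vectorE T e f (t : T) :
  dim_vector T e f << t >> = `[< crosses e f (\val t) >]%:R.
Proof. by rewrite /= /dim_fun liftU scale1r. Qed.

Definition supp T (c : K0split_dual T) : set T := [set t | c << t >> != 0].

Definition dim_vectors Z T : set (K0split_dual T) :=
  [set c | exists a b, [/\ Z a, Z b, a <> b & c = dim_vector T a b]] `\ 0.

Definition dim_vectors_below Z T e f : set (K0split_dual T) :=
  [set d | dim_vectors Z T d /\ supp T d `<=` supp T (dim_vector T e f)].

Definition K0split_dual_at Z T e f : set (K0split_dual T) :=
  zspan (dim_vectors_below Z T e f).

Set Implicit Arguments.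

End Circle.

Arguments circle R : clear implicits.
Arguments dim_fun {R} T e f.
Arguments dim_fun_additive {R} T e f.
Arguments dim_vector {R} T e f.
Arguments dim_vectorE {R} T e f t.
Arguments supp {R T} c.
Arguments dim_vectors {R} Z T.
Arguments dim_vectors_below {R} Z T e f.
Arguments K0split_dual_at {R} Z T e f.

Section Roots.

(* The adjoined least element is the infinity -oo of \bar R. *)
Definition ext (R : realType) (Y : set R) : set (\bar R) :=
  EFin @` Y `|` [set x | x = -oo%E /\ exists2 m, Y m & lbound Y m].

Definition root_lattice (K : choiceType) (Y : set K) : set (free_group Y) :=
  zspan [set v | exists y y' : Y, y <> y' /\ v = << y >> - << y' >>].

Definition positive_roots d (K : orderType d) (Y : set K) : set (free_group Y) :=
  [set v | exists y y' : Y, (\val y' < \val y)%O /\ v = << y >> - << y' >>].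

End Roots.

Arguments root_lattice {K} Y.
Arguments positive_roots {d K} Y.

(* Main.v *)
(** Points of the circle are lifted to angles, so that cyclic order becomes the
order of the reals within one turn.  The diagonals of [T] together with the pairs
of neighbours of [Z] form a frame: its members do not cross, and by maximality two
points of [Z] whose pair is not crossed by [T] are joined.  The fountain or
leapfrog at a limit point forces the neighbours of a vertex inside an arc to have a
last element; hence every frame member has a triangle on each side that meets [Z].

For [e], [f] in the closure of [Z], these triangles give every diagonal of [T]
crossing [{e, f}] an immediate predecessor (unless it is the first) and show that
the supports of the [dim {a, b}] contained in that of [dim {e, f}] are exactly the
intervals [(y', y]] of the trace, with [y' < y] in its extension.  Sending [eps_y]
to the indicator function of the diagonals up to [y] maps the positive root
[eps_y - eps_y'] to the indicator function of [(y', y]]; the coefficient at the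
largest element of a support shows that this map is injective on the root lattice,
and its inverse is the required isomorphism. *)
From HB Require Import structures.
From Pilot Require Import Defs.
From mathcomp Require Import all_boot all_order all_algebra.
From mathcomp Require Import freeg.
From mathcomp Require Import all_classical all_reals all_analysis.
From mathcomp Require Import ring lra.

Set Implicit Arguments.
Unset Strict Implicit.
Unset Printing Implicit Defensive.

Import Order.TTheory GRing.Theory Num.Theory.
Import numFieldNormedType.Exports.

Local Open Scope classical_set_scope.
Local Open Scope card_scope.
Local Open Scope ring_scope.

(** * Angles and orientation *)

Section Angles.
Variable R : realType.
Local Notation point := (R * R)%type.
Local Notation cis := (@cis R).
Implicit Types (a b c d x y z : R) (p q r : point).

(** Twice the signed area of the triangle [p q r]: its sign is the orientation, and it is affine in
    each point. *)
Definition det p q r : R :=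
  (q.1 - p.1) * (r.2 - p.2) - (q.2 - p.2) * (r.1 - p.1).

Lemma cisD x y z : cis x = cis y -> cis (z + x) = cis (z + y).
Proof. by move=> [cxy sxy]; rewrite /Defs.cis !cosD !sinD cxy sxy. Qed.

Lemma cis_translate x y z : cis x = cis y -> cis (z - x + y) = cis z.
Proof. by move=> /(cisD (z - x)) <-; rewrite subrK. Qed.

Lemma cis_periodic x : cis (x + 2 * pi) = cis x.
Proof.
by rewrite /Defs.cis mulrC mulr_natr cosD2pi sinD2pi.
Qed.

Lemma cis_periodicN x : cis (x - 2 * pi) = cis x.
Proof. by rewrite -[in RHS](subrK (2 * pi) x) cis_periodic. Qed.

(** For increasing angles within one turn all half-differences lie strictly between 0 and [pi], so
    this half-angle factorisation shows the sign. *)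
Lemma det_cis x y z :
  det (cis x) (cis y) (cis z) =
  4 * (sin ((y - x) / 2) * sin ((z - y) / 2) * sin ((z - x) / 2)).
Proof.
set u := (y - x) / 2; set v := (z - y) / 2.
have -> : (z - x) / 2 = u + v by rewrite /u /v; field.
have -> : y = x + (u + u) by rewrite /u; field.
have -> : z = x + (u + u) + (v + v) by rewrite /u /v; field.
have cosDD w : cos (w + w) = 1 - 2 * sin w ^+ 2.
  by rewrite cosD -[X in _ = X - _](cos2Dsin2 w); ring.
have sinDD w : sin (w + w) = 2 * (sin w * cos w) by rewrite sinD; ring.
rewrite -[x + _ + _]addrA /det /Defs.cis /= !(cosD x) !(sinD x).
rewrite (cosD (u + u)) (sinD (u + u)).
set C := cos (u + u); set S := sin (u + u).
set C' := cos (v + v); set S' := sin (v + v).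
transitivity (S' * (1 - C) + S * (1 - C')); last first.
  by rewrite /S /S' /C /C' !cosDD !sinDD sinD; ring.
have E : C ^+ 2 + S ^+ 2 = 1 by exact: cos2Dsin2.
transitivity ((cos x ^+ 2 + sin x ^+ 2) *
  ((C ^+ 2 + S ^+ 2) * S' + S - (S * C' + C * S'))); first by ring.
by rewrite E cos2Dsin2; ring.
Qed.

Lemma det_cis_gt0 x y z : x < y -> y < z -> z < x + 2 * pi ->
  0 < det (cis x) (cis y) (cis z).
Proof.
move=> xy yz zx; rewrite det_cis.
by do ?apply: mulr_gt0; rewrite // sin_gt0_pi //; lra.
Qed.

Lemma cis_inj x y : cis x = cis y -> `|x - y| < 2 * pi -> x = y.
Proof.
move=> exy dxy; apply: contrapT => /eqP xy.
wlog lt_xy : x y exy dxy xy / x < y.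
  move=> W; case/orP: (real_leVge (num_real x) (num_real y)) => le_xy.
    by apply: (W x y) => //; rewrite lt_neqAle xy.
  by apply: (W y x) => //; rewrite 1?distrC 1?eq_sym // lt_neqAle eq_sym xy.
have yx : y < x + 2 * pi.
  by move: dxy; rewrite ltr_norml => /andP[]; lra.
(* If the end points coincide, the triangle with the midpoint angle is degenerate, against the
   positivity of [det]. *)
have := @det_cis_gt0 x ((x + y) / 2) y; rewrite -exy.
have -> : det (cis x) (cis ((x + y) / 2)) (cis x) = 0 by rewrite /det; ring.
by rewrite ltxx => W; suff: false by []; apply: W; lra.
Qed.

Lemma cis_eq x y : cis x = cis y -> x - 2 * pi < y < x + 2 * pi -> x = y.
Proof.
by move=> exy xy; apply: cis_inj => //; rewrite ltr_norml; apply/andP; split; lra.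
Qed.

Lemma circle_lift p a : circle R p -> exists2 x, a <= x < a + 2 * pi & p = cis x.
Proof.
have [pi0 pi2] : (0 : R) < pi /\ (0 : R) < 2 * pi.
  by have pi0 := pi_gt0 R; split => //; lra.
have arg q : circle R q -> exists2 x, 0 <= x < 2 * pi & q = cis x.
  case: q => c s E; have {}E : c ^+ 2 + s ^+ 2 = 1 := E.
  have c1 : -1 <= c <= 1.
    rewrite -ler_norml -(@expr_le1 _ 2) // real_normK ?num_real // -E.
    by rewrite lerDl sqr_ge0.
  have sE : Num.sqrt (1 - c ^+ 2) = `|s|.
    by rewrite -E [X in X - _]addrC addrK sqrtr_sqr.
  have [s0|s0] := leP 0 s.
    exists (acos c).
      by have := acos_ge0 c1; have := acos_lepi c1; lra.
    by rewrite /Defs.cis sin_acos // sE ger0_norm // acosK // in_itv.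
  exists (- acos c + 2 * pi).
    have c1' : -1 <= c < 1.
      case/andP: c1 => -> /=; rewrite lt_neqAle => ->; rewrite andbT.
      apply/eqP => cE; have : 0 < s ^+ 2 by rewrite exprn_even_gt0 //= ltr0_neq0.
      by move: E; rewrite cE expr1n; lra.
    by have := acos_gt0 c1'; have := acos_lepi c1; lra.
  rewrite cis_periodic /Defs.cis cosN sinN sin_acos // sE ltr0_norm // opprK.
  by rewrite acosK // in_itv.
case: p => c s E; have {}E : c ^+ 2 + s ^+ 2 = 1 := E.
(* The point is turned by [- a]; adding [a] to its angle gives one in the window that starts at
   [a]. *)
have [|x x0 [cE sE]] := arg (c * cos a + s * sin a, s * cos a - c * sin a).
  rewrite /circle /= -[RHS](mulr1 1) -{1}E -(cos2Dsin2 a); ring.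
exists (x + a); first by lra.
rewrite /Defs.cis cosD sinD -cE -sE; have := cos2Dsin2 a => Ea; congr (_, _).
  by rewrite -{1}[c]mulr1 -Ea; ring.
by rewrite -{1}[s]mulr1 -Ea; ring.
Qed.
End Angles.

(** * Cyclic order and crossings in angle coordinates *)

Section CyclicOrder.
Variable R : realType.
Local Notation point := (R * R)%type.
Local Notation cis := (@cis R).
Implicit Types (a b c d x y z : R) (p q r : point) (s : seq point) (t : set point).

Lemma set2_inj (U : Type) (a b c d : U) :
  [set a; b] = [set c; d] -> (a = c /\ b = d) \/ (a = d /\ b = c).
Proof.
move=> E.
have ha : [set c; d] a by rewrite -E; left.
have hb : [set c; d] b by rewrite -E; right.
have hc : [set a; b] c by rewrite E; left.
have hd : [set a; b] d by rewrite E; right.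
by case: ha hb hc hd => [?|?] [?|?] [?|?] [?|?];
  (left; split; congruence) || (right; split; congruence).
Qed.

(* Plain injection would also split the points into their coordinates. *)
Lemma cons_inj (U : Type) (a b : U) (s t : seq U) :
  a :: s = b :: t -> a = b /\ s = t.
Proof. by case. Qed.

(** The witness of a cyclic order starts at some lift [v] of the first point; shifting it by [x - v]
    changes no point and makes it start at the given lift. *)
Lemma ccw_from x s : ccw (cis x :: s) ->
  exists u : seq R, [/\ s = [seq cis i | i <- u], path <%R x u &
                     last x u < x + 2 * pi].
Proof.
move=> [[|v u] [E su lu]]; first by [].
have [ex ->] := cons_inj E.
have xE : x = x - v + v by rewrite subrK.
exists [seq x - v + i | i <- u]; split.
- rewrite -map_comp; apply: eq_map => i /=.
  by rewrite [x - v + i]addrC addrCA addrC cis_translate // ex.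
- rewrite [X in path _ X]xE path_map; apply: sub_path su => i j /=.
  by rewrite ltrD2l.
- by rewrite [X in last X]xE last_map; move: lu => /=; lra.
Qed.

Lemma ccw_cis x (u : seq R) : path <%R x u -> last x u < x + 2 * pi ->
  ccw [seq cis i | i <- x :: u].
Proof. by move=> xu lu; exists (x :: u). Qed.

Lemma ccw3 x y z : x < y -> y < z -> z < x + 2 * pi ->
  ccw [:: cis x; cis y; cis z].
Proof. by move=> xy yz zx; apply: (@ccw_cis x [:: y; z]) => //=; rewrite xy yz. Qed.

Lemma ccw4 x y z a : x < y -> y < z -> z < a -> a < x + 2 * pi ->
  ccw [:: cis x; cis y; cis z; cis a].
Proof.
by move=> xy yz za ax; apply: (@ccw_cis x [:: y; z; a]) => //=; rewrite xy yz za.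
Qed.

Lemma ccw_rot p s : ccw (p :: s) -> ccw (rcons s p).
Proof.
move=> [[|v u] [E su lu]]; first by [].
have {E} [-> ->] := cons_inj E.
exists (rcons u (v + 2 * pi)); split.
- by rewrite map_rcons cis_periodic.
- by case: u su lu => //= w u /andP[_ wu] lu; rewrite rcons_path wu.
- rewrite last_rcons; case: u su lu => [|w u] /=; first by have := pi_gt0 R; lra.
  by move=> /andP[vw _] _; rewrite ltrD2r.
Qed.

Lemma ccw3_between x y p : x < y < x + 2 * pi -> ccw [:: cis x; p; cis y] ->
  exists2 z, x < z < y & p = cis z.
Proof.
move=> xy /ccw_from[[|z [|w [|w' u]]] [E //= /and3P[xz zw _] wx]].
have {E} [-> E] := cons_inj E; have {E} [e _] := cons_inj E.
by have -> : y = w; [apply: cis_eq => //; lra|exists z => //; rewrite xz].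
Qed.

Lemma ccw4_between x y p q : x < y < x + 2 * pi -> ccw [:: cis x; p; cis y; q] ->
  exists a b, [/\ x < a < y, y < b < x + 2 * pi, p = cis a & q = cis b].
Proof.
move=> xy /ccw_from[[|z [|w [|v [|v' u]]]] [E //= /and4P[xz zw wv _] vx]].
have {E} [-> E] := cons_inj E; have {E} [e E] := cons_inj E.
have {E} [-> _] := cons_inj E.
have -> : y = w by apply: cis_eq => //; lra.
by exists z, v; split=> //; apply/andP.
Qed.

Lemma crossesC p q t : crosses p q t -> crosses q p t.
Proof.
move=> [t0 [t1 [-> [/ccw_rot/ccw_rot|/ccw_rot/ccw_rot] h]]].
  by exists t0, t1; split=> //; right.
by exists t0, t1; split=> //; left.
Qed.

Lemma crosses_between x y t : x < y < x + 2 * pi -> crosses (cis x) (cis y) t ->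
  exists a b, [/\ x < a < y, y < b < x + 2 * pi & t = [set cis a; cis b]].
Proof.
move=> xy [t0 [t1 [-> [|] /ccw4_between]]] /(_ xy)[a [b [ha hb -> ->]]].
  by exists a, b.
by exists a, b; split=> //; rewrite setUC.
Qed.

Lemma crossesI a x b y : a < x -> x < b -> b < y -> y < a + 2 * pi ->
  crosses (cis a) (cis b) [set cis x; cis y].
Proof. by move=> *; exists (cis x), (cis y); split=> //; left; exact: ccw4. Qed.

(** In contrast to [crosses_between], the crossed pair is lifted first. The end point on the outer
    arc is moved back one turn, which gives the linear order [a < x < b < y]. *)
Lemma crosses_sides x y p q : x < y < x + 2 * pi -> crosses p q [set cis x; cis y] ->
  exists a b, [/\ y - 2 * pi < a < x, x < b < y &
    (p = cis a /\ q = cis b) \/ (p = cis b /\ q = cis a)].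
Proof.
move=> xy [t0 [t1 [E c]]]; have h := set2_inj E.
suff : ccw [:: cis x; p; cis y; q] \/ ccw [:: cis x; q; cis y; p].
  case=> /(ccw4_between xy)[b [a [hb ha -> ->]]]; exists (a - 2 * pi), b;
    rewrite cis_periodicN; split=> //; try (by left); try (by right); lra.
by case: h c => [[-> ->]|[-> ->]] [] /ccw_rot c;
  [right|left; move/ccw_rot/ccw_rot: c|left; move/ccw_rot/ccw_rot: c|right].
Qed.

End CyclicOrder.

(** * Diagonals and neighbours *)

Section Frame.
Variables (R : realType) (Z : set (R * R)) (T : set (set (R * R))).
Local Notation point := (R * R)%type.
Local Notation cis := (@cis R).
Implicit Types (a b c d x y z : R) (p q r : point) (t : set point).

(** Edges are taken between angles rather than points: periodicity in both arguments allows any edge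
    to be shifted into a convenient window. *)
Definition frame x y : Prop := [/\ Z (cis x), Z (cis y) &
  T [set cis x; cis y] \/ is_succ Z (cis x) (cis y) \/ is_succ Z (cis y) (cis x)].

Lemma frameC x y : frame x y -> frame y x.
Proof. by move=> [Zx Zy h]; split=> //; move: h; rewrite setUC; tauto. Qed.

Lemma frameDl x y : frame (x + 2 * pi) y <-> frame x y.
Proof. by rewrite /frame cis_periodic. Qed.

Lemma frameDr x y : frame x (y + 2 * pi) <-> frame x y.
Proof. by rewrite /frame cis_periodic. Qed.

Lemma frameBl x y : frame (x - 2 * pi) y <-> frame x y.
Proof. by rewrite /frame cis_periodicN. Qed.

Hypothesis Tdiag : T `<=` Defs.diagonal Z.
Hypothesis Tnc : noncrossing T.

Lemma T_frame x y : T [set cis x; cis y] -> frame x y.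
Proof.
move=> h; have [z1 [z2 [[Z1 Z2] _ _ _ E]]] := Tdiag h; split; last by left.
  by case: (set2_inj E) => -[-> _].
by case: (set2_inj E) => -[_ ->].
Qed.

(** Two diagonals do not cross by assumption. A pair of neighbours crosses nothing, because a
    crossing would put a point of [Z] into its empty arc. *)
Lemma frame_noncrossing a c b d :
  a < c -> c < b -> b < d -> d < a + 2 * pi -> frame a b -> frame c d -> False.
Proof.
move=> ac cb bd da [Za Zb hab] [Zc Zd hcd].
case: hab => [Tab|[[_ _ _ h]|[_ _ _ h]]].
- case: hcd => [Tcd|[[_ _ _ h]|[_ _ _ h]]].
  + by apply: (Tnc Tab Tcd); exact: crossesI.
  + by apply: (h _ Zb); apply: ccw3; lra.
  + by apply: (h _ Za); rewrite -(cis_periodic a) -(cis_periodic c); apply: ccw3; lra.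
- by apply: (h _ Zc); apply: ccw3; lra.
- by apply: (h _ Zd); rewrite -(cis_periodic a); apply: ccw3; lra.
Qed.

Hypothesis Tmax :
  forall T', T' `<=` Defs.diagonal Z -> noncrossing T' -> T `<=` T' -> T' = T.

(** Unless [x] and [y] are neighbours, their pair is a diagonal that can be added to [T] without
    creating a crossing, so it belongs to [T] already. *)
Lemma frame_maximal x y : x < y < x + 2 * pi -> Z (cis x) -> Z (cis y) ->
  (forall a b, x < a < y -> y < b < x + 2 * pi -> ~ T [set cis a; cis b]) ->
  frame x y.
Proof.
move=> xy Zx Zy nT; split=> //; apply: contrapT => /not_orP[nTxy /not_orP[nxy nyx]].
apply: nTxy; set t := [set _; _].
suff <- : T `|` [set t] = T by right.
have nxyE : cis x <> cis y by move=> /cis_eq; lra.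
apply: Tmax; last by move=> ? ?; left.
  by move=> _ [/Tdiag //|->]; exists (cis x), (cis y).
move=> p q s [Tpq|pqE] [Ts|->]; first exact: Tnc.
- move=> /(crosses_sides xy)[a [b [ha hb h]]].
  apply: (nT b (a + 2 * pi)); rewrite ?cis_periodic //; first lra.
  by case: h Tpq => [] [-> ->] //; rewrite setUC.
- move=> h; have {h}: crosses (cis x) (cis y) s.
    by case: (set2_inj pqE) h => -[-> ->] // /crossesC.
  by move=> /(crosses_between xy)[a [b [ha hb E]]]; apply: (nT a b) => //; rewrite -E.
- move=> /(crosses_sides xy)[a [b [ha hb h]]].
  have [_ hb' ] : cis b <> cis x /\ cis b <> cis y by split=> /cis_eq; lra.
  by case: (set2_inj pqE) h => -[-> ->] [] [/cis_eq ? /cis_eq ?]; lra.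
Qed.

End Frame.

(** * Limit points and triangles *)

Section Limits.
Variables (R : realType).
Local Notation point := (R * R)%type.
Local Notation cis := (@cis R).
Implicit Types (a b c d v w x y : R) (p q r : point) (z : nat -> point).

Lemma continuous_cis : continuous cis.
Proof.
move=> x; apply: (@cvg_pair _ _ _ _ (nbhs (cos x)) (nbhs (sin x))).
  exact: continuous_cos.
exact: continuous_sin.
Qed.

Lemma limit_point_cis (Z : set point) x :
  (forall d, 0 < d -> exists y, [/\ 0 < `|y - x|, `|y - x| < d & Z (cis y)]) ->
  limit_point Z (cis x).
Proof.
move=> H U /(@continuous_cis x) /nbhs_ballP[d /= d0 dU].
have p2 : 0 < 2 * pi :> R by have := pi_gt0 R; lra.
(* The bound [2 * pi] keeps [y] within one turn of [x], so that [cis y] differs from [cis x]. *)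
have [|y [y0 yd Zy]] := H (Order.min d (2 * pi)); first by rewrite lt_min d0.
exists (cis y); split=> //.
  apply/eqP => /cis_inj e; move: y0; rewrite e ?subrr ?normr0 ?ltxx //.
  by move: yd; rewrite lt_min => /andP[].
by apply: dU; rewrite /ball /= distrC; move: yd; rewrite lt_min => /andP[].
Qed.

Lemma cvg_after_lift z x : cvg_after z (cis x) -> forall w, x < w ->
  exists N, forall n, (N <= n)%N -> exists2 v, x < v < w & z n = cis v.
Proof.
move=> [x0 [u [ex zE cu]]] w xw.
have A : \forall n \near \oo, x0 < u n < x0 + (w - x).
  apply: (cu [set v | x0 < v < x0 + (w - x)]); near=> v; apply/andP; split=> //.
  by near: v; apply: nbhs_right_lt; lra.
case: A => N _ HN; exists N => n /HN /= h.
exists (u n - x0 + x); first by lra.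
by rewrite zE cis_translate.
Unshelve. all: by end_near. Qed.

Lemma cvg_before_lift z x : cvg_before z (cis x) -> forall w, w < x ->
  exists N, forall n, (N <= n)%N -> exists2 v, w < v < x & z n = cis v.
Proof.
move=> [x0 [u [ex zE cu]]] w xw.
have A : \forall n \near \oo, x0 + (w - x) < u n < x0.
  apply: (cu [set v | x0 + (w - x) < v < x0]); near=> v; apply/andP; split=> //.
  by near: v; apply: nbhs_left_gt; lra.
case: A => N _ HN; exists N => n /HN /= h.
exists (u n - x0 + x); first by lra.
by rewrite zE cis_translate.
Unshelve. all: by end_near. Qed.

End Limits.

(** * Fans of neighbours and triangles of the frame *)

Section Fan.
Variables (R : realType) (Z : set (R * R)) (T : set (set (R * R))).
Local Notation point := (R * R)%type.
Local Notation cis := (@cis R).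
Local Notation frame := (frame Z T).
Implicit Types (a b c d v w x y : R) (p q r : point) (t : set point).

Hypothesis hZ : Z `<=` circle R.
Hypothesis hZdiscrete : forall z, Z z -> ~ limit_point Z z.
Hypothesis hZlimit : forall y : point, limit_point Z y -> two_sided_limit Z y.
Hypothesis hT : triangulation Z T.

Let Tdiag : T `<=` Defs.diagonal Z. Proof. by case: hT. Qed.
Let Tnc : noncrossing T. Proof. by case: hT. Qed.
Let Tmax T' : T' `<=` Defs.diagonal Z -> noncrossing T' -> T `<=` T' -> T' = T.
Proof. by case: hT => _ _ h _; exact: h. Qed.

(** A common form for both cases: close to the limit point, a leapfrog gives one diagonal passing
    over it, a fountain gives two diagonals with a common end. *)
Lemma surrounded x a b : limit_point Z (cis x) -> a < x -> x < b ->
  exists w' w, [/\ a < w' < x, x < w < b &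
    T [set cis w'; cis w] \/ exists z, [/\ Z z, T [set cis w'; z] & T [set cis w; z]]].
Proof.
case: hT => _ _ _ h /h{h}[[z [u [v [Zz Tuv cu cv]]]]|[z [Tz lz]]] ax xb.
  have [N1 /(_ N1 (leqnn _))[w hw wE]] := cvg_after_lift cu xb.
  have [N2 /(_ N2 (leqnn _))[w' hw' wE']] := cvg_before_lift cv ax.
  exists w', w; split=> //; right; exists z; rewrite -wE -wE'.
  by split=> //; [case: (Tuv N2)|case: (Tuv N1)].
case: lz => -[].
  move=> /cvg_after_lift/(_ b xb)[N1 H1] /cvg_before_lift/(_ a ax)[N2 H2].
  (* The same index is used on both sides, so that the two points are consecutive in the leapfrog
     and form a diagonal. *)
  have [w hw wE] := H1 _ (leq_maxl N1 N2).
  have [w' hw' wE'] := H2 _ (leq_maxr N1 N2).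
  by exists w', w; split=> //; left; rewrite setUC -wE -wE'.
move=> /cvg_before_lift/(_ a ax)[N1 H1] /cvg_after_lift/(_ b xb)[N2 H2].
have [w hw wE] := H1 _ (leq_maxl N1 N2).
have [w' hw' wE'] := H2 _ (leq_maxr N1 N2).
by exists w, w'; split=> //; left; rewrite -wE -wE'.
Qed.

(** The successor is the infimum of the points of [Z] after [a]. Were it not attained, it would be a
    limit point other than [a], and the points of [Z] approaching it from below would contradict the
    infimum. *)
Lemma succ_exists a b : a < b < a + 2 * pi -> Z (cis a) -> Z (cis b) ->
  exists2 x, a < x <= b & is_succ Z (cis a) (cis x).
Proof.
move=> ab Za Zb; pose S := [set x | a < x <= b /\ Z (cis x)].
have Sb : S b by split=> //; lra.
have Sinf : has_inf S.
  by split; [exists b|exists a => x [/andP[/ltW]]].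
have am : a <= inf S by apply: lb_le_inf; [exists b|move=> x [/andP[/ltW]]].
have lbm x : S x -> inf S <= x by move=> Sx; apply: ge_inf => //; case: Sinf.
have mb := lbm _ Sb.
have [Sm|nSm] := pselect (S (inf S)).
  exists (inf S); first by case: Sm.
  have amlt : a < inf S by case: Sm => /andP[].
  split=> //; first by case: Sm.
    by move=> /cis_eq; lra.
  move=> p Zp /ccw3_between[|x hx pE]; first lra.
  suff /lbm : S x by lra.
  by split; [lra|rewrite -pE].
have Lm : limit_point Z (cis (inf S)).
  apply: limit_point_cis => d d0.
  have [x Sx xd] := inf_adherent d0 Sinf; have := lbm _ Sx => mx.
  have nE : inf S != x by apply/eqP => E; apply: nSm; rewrite E.
  have mx' : inf S < x by rewrite lt_neqAle nE.
  by exists x; case: Sx => _ Zx; split=> //; rewrite gtr0_norm; lra.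
have am' : a < inf S.
  by rewrite lt_neqAle am andbT; apply/eqP => E; apply: (hZdiscrete Za); rewrite {1}E.
have [_ [z [Zz cz]]] := hZlimit Lm.
have [N /(_ N (leqnn _))[x hx zE]] := cvg_before_lift cz am'.
suff /lbm : S x by lra.
by split; [lra|rewrite -zE].
Qed.

(** Were the supremum of the neighbours of [a] not attained, it would be a limit point. A leapfrog
    diagonal around it crosses an edge from [a] to a neighbour close to the supremum. So does one of
    the two fountain diagonals, unless the fountain is based at [a], and then it yields a neighbour
    beyond the supremum. *)
Lemma fan_max a b x0 : a < x0 -> x0 < b -> b < a + 2 * pi -> Z (cis b) ->
  frame a x0 ->
  exists x, [/\ a < x, x < b, frame a x & forall y, x < y -> y < b -> ~ frame a y].
Proof.
move=> ax0 x0b ba Zb F0; pose S := [set x | a < x < b /\ frame a x].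
have Sx0 : S x0 by split=> //; lra.
have Ssup : has_sup S by split; [exists x0|exists b => x [/andP[_ /ltW]]].
have ubs x : S x -> x <= sup S by move=> Sx; apply: ub_le_sup => //; case: Ssup.
have x0s := ubs _ Sx0.
have sb : sup S <= b by apply: ge_sup; [exists x0|move=> x [/andP[_ /ltW]]].
have [[sab Fs]|nSs] := pselect (S (sup S)).
  exists (sup S); split=> //; try lra.
  move=> y sy yb Fy; suff /ubs : S y by lra.
  by split=> //; lra.
have adh w : w < sup S -> exists2 x, S x & w < x < sup S.
  move=> ws; have [|x Sx xw] := @sup_adherent _ S (sup S - w) _ Ssup; first lra.
  exists x => //; have := ubs _ Sx; rewrite le_eqVlt => /predU1P[E|]; last lra.
  by case: nSs; rewrite -E.
have Ls : limit_point Z (cis (sup S)).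
  apply: limit_point_cis => d d0.
  have [|x [_ [_ Zx _]] xd] := adh (sup S - d); first lra.
  by exists x; split=> //; rewrite distrC gtr0_norm; lra.
have sb' : sup S < b.
  rewrite lt_neqAle sb andbT; apply/eqP => E.
  by apply: (hZdiscrete Zb); rewrite -E.
have x0s' : x0 < sup S.
  by have [|x _] := adh (sup S - 1); [lra|move=> /andP[]; have := ubs _ Sx0;
    rewrite le_eqVlt => /predU1P[E|//]; case: nSs; rewrite -E].
have [w' [w [hw' hw Tw]]] := surrounded Ls x0s' sb'.
have nc x c d : S x -> a < c -> c < x -> x < d -> d < a + 2 * pi ->
    ~ T [set cis c; cis d].
  move=> [_ Fx] ac cx xd da /(T_frame Tdiag) Fcd.
  exact: (frame_noncrossing Tnc ac cx xd da Fx Fcd).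
have [|x Sx hx] := adh w'; first lra.
case: Tw => [Tw|[z [Zz Tw' Tw]]]; first by case: (@nc x w' w) => //; lra.
have [y hy zE] := @circle_lift _ _ a (hZ Zz); rewrite zE in Zz Tw' Tw.
case: (ltgtP y (sup S)) => [ys|ys|ysE].
- have [ya|ya] := eqVneq y a.
    suff /ubs : S w by lra.
    by split; [lra|apply: frameC; apply: (T_frame Tdiag); rewrite -ya].
  have ay : a < y by rewrite lt_neqAle eq_sym ya; case/andP: hy.
  have [x' Sx' hx'] := adh y ys.
  by case: (@nc x' y w); rewrite 1?setUC //; lra.
- by case: (@nc x w' y) => //; lra.
- by case: (hZdiscrete Zz); rewrite ysE.
Qed.

(** The apex is the last neighbour [p] of [x] before [y]. A diagonal crossing [{p, y}] would cross
    [{x, y}] or [{x, p}], or end at [x] and give a later neighbour; hence [{p, y}] is an edge by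
    maximality. *)
Lemma frame_triangle x y m : x < m -> m < y -> y < x + 2 * pi -> Z (cis m) ->
  frame x y -> exists z, [/\ x < z, z < y, frame x z & frame z y].
Proof.
move=> xm my yx Zm Fxy; have [Zx Zy _] := Fxy.
have [|s /andP[xs sm] xS] := @succ_exists x m _ Zx Zm; first lra.
have [||p [xp py Fxp pmax]] := @fan_max x y s xs _ yx Zy; first lra.
  by split=> //; [case: xS|right; left].
exists p; split=> //; have [_ Zp _] := Fxp.
apply: (frame_maximal Tdiag Tnc Tmax) => //; first lra.
move=> c d hc hd /(T_frame Tdiag) Fcd.
case: (ltgtP d (x + 2 * pi)) => [dx|dx|dE].
- by apply: (@frame_noncrossing _ Z _ Tnc x c y d) => //; lra.
- apply: (@frame_noncrossing _ Z _ Tnc x (d - 2 * pi) p c) => //; try lra.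
  by apply/frameBl/frameC.
- by apply: (pmax c); try lra; apply/frameDl/frameC; rewrite -dE.
Qed.

(** This is the triangle at [a] through which the segment [{a, b}] leaves. With [p] the last
    neighbour of [a] before [b], the triangle over [{p, a}] on the side of [b] has its apex beyond
    [b]: before [b] it would contradict the choice of [p], and at [b] it would make [{a, b}] an
    edge, crossed by [{x, y}]. *)
Lemma crossed_triangle a b x y : a < x -> x < b -> b < y -> y < a + 2 * pi ->
  Z (cis a) -> Z (cis b) -> T [set cis x; cis y] ->
  exists c d, [/\ a < c < b, b < d < a + 2 * pi, frame a c, frame a d & frame c d].
Proof.
move=> ax xb yb ya Za Zb Txy; have Fxy := T_frame Tdiag Txy.
have nab : ~ frame a b.
  by move=> Fab; exact: (frame_noncrossing Tnc ax xb yb ya Fab Fxy).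
have [|s hs aS] := @succ_exists a b _ Za Zb; first lra.
have Fas : frame a s by split=> //; [case: aS|right; left].
have sb : s < b.
  by case: (ltgtP s b) => [//||E]; [lra|case: nab; rewrite -E].
have [||p [ap pb Fap pmax]] := @fan_max a b s _ sb _ Zb Fas; try lra.
have [||||q [pq qa Fpq Fqa]] := @frame_triangle p (a + 2 * pi) b _ _ _ Zb; try lra.
  by apply/frameDr/frameC.
have {}Fqa : frame a q by apply/frameDl/frameC.
exists p, q; split=> //; try lra.
case: (ltgtP q b) => [qb|qb|qE]; [|lra|].
  by case: (pmax q).
by case: nab; rewrite -qE.
Qed.

Lemma closure_between x y a : x < a -> a < y -> y < x + 2 * pi ->
  closure Z (cis a) -> exists2 m, x < m < y & Z (cis m).
Proof.
move=> xa ay yx clZ.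
(* The open arc from [x] to [y] is cut out of the circle by an open half-plane, so it contains
   points of [Z] close to [cis a]. *)
have dc : det (cis x) p (cis y) @[p --> cis a] --> det (cis x) (cis a) (cis y).
  rewrite /det; apply: cvgB; apply: cvgM; try exact: cvg_cst;
    apply: cvgB; try exact: cvg_cst.
    exact: cvg_fst.
  exact: cvg_snd.
have /clZ[p [Zp /= dp]] : nbhs (cis a) [set p | 0 < det (cis x) p (cis y)].
  apply: (dc [set r | 0 < r]); apply: open_nbhs_nbhs; split; first exact: open_gt.
  exact: det_cis_gt0.
have [m hm pE] := @circle_lift _ _ x (hZ Zp); rewrite pE in dp Zp; exists m => //.
case/andP: hm => xm mx; apply/andP; split; rewrite ltNge; apply/negP => h.
  have E : m = x by lra.
  by move: dp; rewrite E /det !subrr !mul0r subrr ltxx.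
have [E|ym] := eqVneq m y; first by move: dp; rewrite E /det mulrC subrr ltxx.
have : 0 < det (cis x) (cis y) (cis m) by apply: det_cis_gt0 => //; lra.
have -> : det (cis x) (cis y) (cis m) = - det (cis x) (cis m) (cis y).
  by rewrite /det; ring.
by rewrite oppr_gt0 ltNge ltW.
Qed.

(* A frame edge separating two points of the closure of [Z] is no pair of
   neighbours, since both of its open arcs meet [Z]. *)
Lemma frame_separates x y a b : x < a -> a < y -> y < b -> b < x + 2 * pi ->
  closure Z (cis a) -> closure Z (cis b) -> frame x y -> T [set cis x; cis y].
Proof.
move=> xa ay yb bx cla clb [_ _ [//|[[_ _ _ h]|[_ _ _ h]]]].
  have [|m hm Zm] := closure_between xa ay _ cla; first lra.
  by case: (h _ Zm); apply: ccw3; lra.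
have [|m hm Zm] := closure_between yb bx _ clb; first lra.
by case: (h _ Zm); rewrite -(cis_periodic x); apply: ccw3; lra.
Qed.

Lemma T_between x y : x < y < x + 2 * pi -> T [set cis x; cis y] ->
  exists2 m, x < m < y & Z (cis m).
Proof.
move=> xy /Tdiag[z1 [z2 [[Z1 Z2] z12 n12 n21 E]]].
have [Zx Zy n] : [/\ Z (cis x), Z (cis y) & ~ is_succ Z (cis x) (cis y)].
  by case: (set2_inj E) => -[-> ->].
apply: contrapT => N; apply: n; split=> //; first by move=> /cis_eq; lra.
move=> p Zp /ccw3_between[//|m hm pE]; apply: N.
by exists m => //; rewrite -pE.
Qed.

End Fan.

(** * Crossing points on a segment *)

Section Crossing.
Variable R : realType.
Local Notation point := (R * R)%type.
Local Notation cis := (@cis R).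
Implicit Types (e f x y s : R) (p q r : point) (T : set (set point)).

Lemma det_segment_point p q a b s :
  det p q (segment_point a b s) = (1 - s) * det p q a + s * det p q b.
Proof. by rewrite /det /segment_point /line_path /=; ring. Qed.

Lemma open_segmentC p q : open_segment p q `<=` open_segment q p.
Proof.
move=> _ [s /= + <-]; rewrite in_itv /= => hs.
exists (1 - s); first by rewrite /= in_itv /=; lra.
by rewrite /segment_point /line_path; congr (_, _); ring.
Qed.

(** The parameter on [{e, f}] at which the signed area over the chord [{x, y}], an affine function
    of the parameter, vanishes. *)
Definition crossing_param e f x y : R :=
  det (cis x) (cis y) (cis e) /
  (det (cis x) (cis y) (cis e) - det (cis x) (cis y) (cis f)).

Lemma det_cis_before e x y : e < x -> x < y -> y < e + 2 * pi ->
  0 < det (cis x) (cis y) (cis e).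
Proof. by move=> *; rewrite -(cis_periodic e); apply: det_cis_gt0; lra. Qed.

Lemma det_cis_between f x y : x < f -> f < y -> y < x + 2 * pi ->
  det (cis x) (cis y) (cis f) < 0.
Proof.
move=> *; rewrite -oppr_gt0.
have <- : det (cis x) (cis f) (cis y) = - det (cis x) (cis y) (cis f).
  by rewrite /det; ring.
exact: det_cis_gt0.
Qed.

(** Normalised lifts of a crossing pair: [x] lies on the arc from [e] to [f] and [y] on the arc from
    [f] back to [e]. *)
Definition interlaced e f x y := [/\ e < x, x < f, f < y & y < e + 2 * pi].

Lemma crossing_param_itv e f x y : interlaced e f x y ->
  0 < crossing_param e f x y < 1.
Proof.
move=> [ex xf fy ye]; rewrite /crossing_param.
have De := @det_cis_before e x y ex (lt_trans xf fy) ye.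
have Df : det (cis x) (cis y) (cis f) < 0 by apply: det_cis_between => //; lra.
by rewrite divr_gt0 ?ltr_pdivrMr //; lra.
Qed.

Lemma crossing_point e f x y : interlaced e f x y ->
  open_segment (cis x) (cis y) (segment_point (cis e) (cis f) (crossing_param e f x y)).
Proof.
move=> xy; case: (xy) => ex xf fy ye.
have De := @det_cis_before e x y ex (lt_trans xf fy) ye.
have Df : det (cis x) (cis y) (cis f) < 0 by apply: det_cis_between => //; lra.
(* Along the other chord the same point is given by the same formula with the two chords
   exchanged. *)
exists (crossing_param x y e f).
  rewrite /= in_itv /= /crossing_param.
  have : det (cis e) (cis f) (cis x) < 0 by apply: det_cis_between => //; lra.
  have : 0 < det (cis e) (cis f) (cis y) by apply: det_cis_gt0 => //; lra.
  move: (det _ _ (cis y)) (det _ _ (cis x)) => u v u0 v0.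
  by rewrite -mulrNN -invrN opprB divr_gt0 ?ltr_pdivrMr //; lra.
rewrite /segment_point /line_path /crossing_param.
have E : det (cis e) (cis f) (cis x) - det (cis e) (cis f) (cis y) =
    - (det (cis x) (cis y) (cis e) - det (cis x) (cis y) (cis f)).
  by rewrite /det; ring.
have : det (cis x) (cis y) (cis e) - det (cis x) (cis y) (cis f) != 0.
  by rewrite gt_eqF //; lra.
by rewrite E /det => nz; congr (_, _); field; rewrite ?oppr_eq0.
Qed.

(** The ends [x'] and [y'] lie weakly on the side of [e] of the chord [{x, y}], at least one of them
    strictly. So does every point inside the chord [{x', y'}], in particular where it meets
    [{e, f}]. *)
Lemma crossing_param_lt e f x y x' y' : interlaced e f x y -> interlaced e f x' y' ->
  x' <= x -> y <= y' -> (x', y') <> (x, y) ->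
  crossing_param e f x' y' < crossing_param e f x y.
Proof.
move=> xy xy' xx yy ne.
have [s' /=] := crossing_point xy'; rewrite in_itv /= => hs' /esym E.
case: (xy) (xy') => ex xf fy ye [ex' xf' fy' ye'].
have := congr1 (det (cis x) (cis y)) E; rewrite !det_segment_point.
have De := @det_cis_before e x y ex (lt_trans xf fy) ye.
have Df : det (cis x) (cis y) (cis f) < 0 by apply: det_cis_between => //; lra.
set s := crossing_param e f x' y'; rewrite /crossing_param.
move=> {}E; rewrite ltr_pdivlMr; last lra.
suff : 0 < (1 - s') * det (cis x) (cis y) (cis x') + s' * det (cis x) (cis y) (cis y').
  by rewrite -E; lra.
have D0 z : z = x \/ z = y -> det (cis x) (cis y) (cis z) = 0.
  by case=> ->; rewrite /det; ring.
have Dx : x' < x -> 0 < det (cis x) (cis y) (cis x').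
  by move=> ?; apply: det_cis_before; lra.
have Dy : y < y' -> 0 < det (cis x) (cis y) (cis y').
  by move=> ?; apply: det_cis_gt0; lra.
have [xE|xx'] := eqVneq x' x; last first.
  have {}Dx := Dx ltac:(rewrite lt_neqAle xx' //).
  apply: ltr_wpDr; last by apply: mulr_gt0 => //; lra.
  have [->|yy'] := eqVneq y' y; first by rewrite D0 ?mulr0 //; right.
  have {}Dy := Dy ltac:(rewrite lt_neqAle eq_sym yy' //).
  by apply: mulr_ge0; [lra|exact: ltW].
rewrite D0 ?mulr0 ?add0r; last by left.
apply: mulr_gt0; first lra.
apply: Dy; rewrite lt_neqAle yy andbT; apply/eqP => yE.
by apply: ne; rewrite xE yE.
Qed.

Lemma trace_crossing T e f x y : interlaced e f x y -> T [set cis x; cis y] ->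
  trace T (cis e) (cis f) (crossing_param e f x y).
Proof.
move=> xy Txy; split; first exact: crossing_param_itv.
by exists (cis x), (cis y); split=> //; exact: crossing_point.
Qed.

Lemma crossing_trace T e f s : e < f -> f < e + 2 * pi ->
  (forall p q, T [set p; q] -> [/\ circle R p, circle R q & p <> q]) ->
  ~ T [set cis e; cis f] -> trace T (cis e) (cis f) s ->
  exists x y, [/\ interlaced e f x y, T [set cis x; cis y] & s = crossing_param e f x y].
Proof.
move=> ef fe Tc nT [hs [p [q [Tpq]]]].
have [/(circle_lift e)[x hx pE] /(circle_lift e)[y hy qE] pq] := Tc _ _ Tpq.
wlog xy : p q x y hx hy pE qE pq Tpq / x < y.
  move=> W; case: (ltgtP x y) => [xy|yx|xy].
  - exact: (W p q x y).
  - by move/open_segmentC; apply: (W q p y x) => //; [exact: nesym|rewrite setUC].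
  - by case: pq; rewrite pE qE xy.
move=> [s' _ /esym E].
have := congr1 (det p q) E; rewrite !det_segment_point.
have -> : det p q p = 0 by rewrite /det; ring.
have -> : det p q q = 0 by rewrite /det; ring.
rewrite !mulr0 addr0 pE qE => {}E.
(* If [e] lay on the chord, so would [f], and the diagonal would be [{e, f}] itself. Otherwise the
   vanishing convex combination [E] puts [e] and [f] on opposite sides. *)
have [ex|ex] := eqVneq x e.
  suff yf : y = f by case: nT; rewrite -yf -ex -pE -qE.
  move: E; rewrite ex.
  have -> : det (cis e) (cis y) (cis e) = 0 by rewrite /det; ring.
  rewrite mulr0 add0r => /eqP; rewrite mulf_eq0 => /orP[/eqP ?|]; first lra.
  case: (ltgtP y f) => // yf.
    by rewrite gt_eqF //; apply: det_cis_gt0 => //; lra.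
  by rewrite lt_eqF //; apply: det_cis_between => //; lra.
have {}ex : e < x by rewrite lt_neqAle eq_sym ex; case/andP: hx.
have De := @det_cis_before e x y ex xy _.
have {}De := De ltac:(lra).
have Df : det (cis x) (cis y) (cis f) < 0.
  rewrite ltNge; apply/negP => Df; nra.
have xf : x < f.
  rewrite ltNge; apply/negP; rewrite le_eqVlt => /predU1P[fx|fx]; move: Df.
    by rewrite fx /det !mulrDl; nra.
  by rewrite ltNge ltW //; apply: det_cis_before => //; lra.
have fy : f < y.
  rewrite ltNge; apply/negP; rewrite le_eqVlt => /predU1P[fx|fx]; move: Df.
    by rewrite fx /det; nra.
  by rewrite ltNge ltW //; apply: det_cis_gt0 => //; lra.
exists x, y; split=> //; first by split=> //; lra.
  by rewrite -pE -qE.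
rewrite /crossing_param; move: De Df E.
move: (det _ _ (cis e)) (det _ _ (cis f)) => u v De Df E.
apply: (@mulIf _ (u - v)).
  by rewrite gt_eqF //; lra.
by rewrite divfK ?gt_eqF //; lra.
Qed.

End Crossing.

(** * The dual lattice of intervals *)

Section GroupHom.
Variables U V : zmodType.

Lemma hom_is_additive (h : Defs.Hom U V) : {morph h : x y / x - y}.
Proof.
case: h => h /= /asboolP hD x y; apply/eqP; rewrite -subr_eq opprK -hD.
by rewrite subrK.
Qed.

HB.instance Definition _ (h : Defs.Hom U V) :=
  GRing.isZmodMorphism.Build U V h (hom_is_additive h).

End GroupHom.

Section Span.
Variable V : zmodType.

Lemma zspan_min (X A : set V) : is_subgroup A -> X `<=` A -> zspan X `<=` A.
Proof. by move=> sA XA; exact: smallest_sub. Qed.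

Lemma zspan_sub (X : set V) : X `<=` zspan X.
Proof. exact: sub_smallest. Qed.

Lemma zspan_subgroup (X : set V) : is_subgroup (zspan X).
Proof.
split=> [A [[A0 _] _] //|u v Xu Xv A [sA XA]].
by case: (sA) => _; apply; [exact: Xu|exact: Xv].
Qed.

End Span.

Lemma image_zspan (V W : zmodType) (h : {additive V -> W}) (X : set V) :
  h @` zspan X = zspan (h @` X).
Proof.
apply/seteqP; split.
  move=> _ [v + <-]; move: v; apply: zspan_min => [|v Xv].
    have [h0 hB] := zspan_subgroup (h @` X).
    by split=> [|u v hu hv]; rewrite /= ?raddf0 ?raddfB //; exact: hB.
  by apply: zspan_sub; exists v.
apply: zspan_min => [|_ [v Xv <-]]; last by exists v => //; exact: zspan_sub.
have [X0 XB] := zspan_subgroup X; split; first by exists 0; rewrite ?raddf0.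
by move=> _ _ [u Xu <-] [v Xv <-]; exists (u - v); [exact: XB|rewrite raddfB].
Qed.

(* The required isomorphism is only prescribed on the span, so it may be any
   section of the embedding [h]. *)
Lemma zmod_iso_section (V W : zmodType) (h : {additive W -> V}) (P : set W) :
  {in zspan P &, injective h} ->
  exists psi : V -> W, zmod_iso (zspan (h @` P)) (zspan P) psi /\
                       set_bij (h @` P) P psi.
Proof.
move=> hI; pose psi v : W := xget (0 : W) [set w | zspan P w /\ h w = v].
have psiK w : zspan P w -> psi (h w) = w.
  move=> Pw; rewrite /psi; case: xgetP => [w' _ [Pw' E]|/(_ w)[]//].
  by apply: hI; rewrite ?inE.
have [P0 PB] := zspan_subgroup P.
have PD u v : zspan P u -> zspan P v -> zspan P (u + v).
  by move=> Pu Pv; rewrite -[v]opprK -[- v]sub0r; apply: (PB) => //; exact: PB.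
exists psi; rewrite -image_zspan; split; [split|].
- move=> _ _ [u Pu <-] [v Pv <-]; rewrite -raddfD !psiK //; exact: PD.
- split.
  + by move=> _ [w Pw <-]; rewrite psiK.
  + move=> _ _ /set_mem[u Pu <-] /set_mem[v Pv <-]; rewrite !psiK // => ->//.
  + by move=> w Pw; exists (h w); [exists w|rewrite psiK].
- have S := @zspan_sub _ P; split.
  + by move=> _ [w Pw <-]; rewrite psiK //; exact: zspan_sub.
  + move=> _ _ /set_mem[u Pu <-] /set_mem[v Pv <-].
    by rewrite !psiK; try exact: zspan_sub; move=> ->.
  + by move=> w Pw; exists (h w); [exists w|rewrite psiK //; exact: zspan_sub].
Qed.

Section FreeGroup.
Variables (K : choiceType) (Y : set K).
Implicit Types (g : Y -> int) (v : free_group Y).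

Lemma fglift_additive g :
  (fglift (g : Y -> int^o) : free_group Y -> int) \in @additive_pred (free_group Y) int.
Proof.
apply/asboolP => x y; have B := @lift_is_additive int Y int^o g.
rewrite -{1}[y]opprK B; congr (_ + _).
by rewrite -[- y]sub0r B -[X in fglift _ X](subrr x) B subrr sub0r opprK.
Qed.

Definition free_hom g : Defs.Hom (free_group Y) int := MkHom (fglift_additive g).

Lemma free_homU g y : free_hom g << y >> = g y.
Proof. by rewrite /= liftU scale1r. Qed.

Lemma free_homE g v : free_hom g v = \sum_(y <- dom v) coeff y v * g y.
Proof.
rewrite -{1}(freeg_sumE v) raddf_sum; apply: eq_bigr => y _.
by rewrite /= liftU.
Qed.

Lemma hom_ext (V : zmodType) (h h' : Defs.Hom (free_group Y) V) :
  (forall y, h << y >> = h' << y >>) -> h = h'.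
Proof.
move=> E; apply: val_inj; apply/funext => v /=.
rewrite -(freeg_sumE v) !raddf_sum; apply: eq_bigr => y _.
by rewrite -[coeff y v]intz -freegU_mulz !raddfMz; congr (_ *~ _); exact: E.
Qed.

Lemma zspan_deg0 (X : set (free_group Y)) :
  (forall v, X v -> deg v = 0) -> forall v, zspan X v -> deg v = 0.
Proof.
move=> X0; apply: zspan_min => //; split; first exact: deg0.
by move=> u v /= u0 v0; rewrite degB u0 v0 subrr.
Qed.

End FreeGroup.

Lemma root_lattice_positive d (K : orderType d) (Y : set K) :
  root_lattice Y = zspan (positive_roots Y).
Proof.
apply/seteqP; split; apply: zspan_min; try exact: zspan_subgroup.
  move=> _ [y [y' [ne ->]]].
  case: (ltgtP (\val y') (\val y)) => [yy|yy|/val_inj E].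
  - by apply: zspan_sub; exists y, y'.
  - have [P0 PB] := zspan_subgroup (positive_roots Y).
    by rewrite -opprB -sub0r; apply: PB => //; apply: zspan_sub; exists y', y.
  - by case: ne.
move=> _ [y [y' [yy ->]]]; apply: zspan_sub; exists y, y'; split=> // E.
by move: yy; rewrite E ltxx.
Qed.

Lemma seq_max d (K : orderType d) (A : eqType) (val : A -> K) (s : seq A) :
  s != [::] -> exists2 y, y \in s & forall z, z \in s -> (val z <= val y)%O.
Proof.
elim: s => // a s IH _; have [->|/IH[y ys ymax]] := eqVneq s [::].
  by exists a => [|z]; rewrite inE // => /eqP ->.
case: (leP (val y) (val a)) => ya.
  exists a => [|z]; rewrite inE ?eqxx // => /predU1P[->//|/ymax zy].
  exact: le_trans ya.
exists y => [|z]; first by rewrite inE ys orbT.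
by rewrite inE => /predU1P[->|/ymax//]; exact: ltW.
Qed.

(** * Embedding the root lattice by indicator functions of rays *)

Section Intervals.
Variables (R : realType) (K : choiceType) (S : set K) (Y : set R).
Variables (A : S -> Prop) (sigma : S -> R).

(** Later [A t] means that [t] crosses [{e, f}], and [sigma t] is the parameter of the crossing. The
    ray below [-oo] is empty, so roots involving the adjoined element yield intervals without a
    lower bound. *)
Definition ray (t : S) (y : ext Y) : int := `[<A t /\ ((sigma t)%:E <= \val y)%E>]%:R.

Definition ray_hom (v : free_group (ext Y)) : Defs.Hom (free_group S) int :=
  free_hom (fun t => free_hom (ray t) v).

Fact ray_hom_is_additive : {morph ray_hom : u v / u - v}.
Proof.
move=> u v; apply: hom_ext => t.
have -> w w' : (ray_hom w - ray_hom w') << t >> = ray_hom w << t >> - ray_hom w' << t >>.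
  by [].
by rewrite !free_homU raddfB.
Qed.

HB.instance Definition _ :=
  GRing.isZmodMorphism.Build (free_group (ext Y)) (Defs.Hom (free_group S) int)
    ray_hom ray_hom_is_additive.

Hypothesis sigmaY : forall s, Y s -> exists2 t, A t & sigma t = s.

(** Let [y] be the largest element in the support of [v]. A diagonal with parameter [y] lies in no
    ray of a smaller element, so evaluating there isolates the coefficient at [y]. *)
Lemma ray_hom_inj : {in zspan (positive_roots (ext Y)) &, injective ray_hom}.
Proof.
move=> u u' /set_mem Pu /set_mem Pu' E; apply/eqP; rewrite -subr_eq0.
set v := u - u'.
have [P0 PB] := zspan_subgroup (positive_roots (ext Y)).
have dv : deg v = 0.
  apply: (@zspan_deg0 _ _ (positive_roots (ext Y))); last exact: PB.
  by move=> _ [y [y' [_ ->]]]; rewrite degB !degU subrr.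
have hv : ray_hom v = 0 by rewrite /v ray_hom_is_additive E subrr.
have v0 t : free_hom (ray t) v = 0.
  by rewrite -(free_homU (fun t => free_hom (ray t) v)) -/(ray_hom v) hv.
rewrite -dom_eq0; apply/negPn/negP => /(seq_max (fun y : ext Y => \val y))[y yv ymax].
have cy : coeff y v != 0 by rewrite -mem_dom.
have [[s [Ys yE]]|yE] : (exists s, Y s /\ \val y = s%:E) \/ \val y = -oo%E.
  by case: (y) => z /= /set_mem[[s Ys <-]|[-> _]]; [left; exists s|right].
- have [t At ts] := sigmaY Ys; move/eqP: cy; apply; rewrite -(v0 t) free_homE.
  rewrite (bigD1_seq y) ?uniq_dom //= big_seq_cond big1 ?addr0.
    by rewrite /ray asboolT ?mulr1 // yE ts.
  move=> z /andP[/ymax zy ne]; rewrite /ray asboolF ?mulr0 // ts -yE => -[_ yz].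
  by case/eqP: ne; apply/val_inj/le_anti; rewrite zy.
(* If the largest element is [-oo], it is the whole support, and degree 0 makes its coefficient
   vanish. *)
- move/eqP: cy; apply; rewrite -dv -[in RHS](freeg_sumE v).
  rewrite (bigD1_seq y) ?uniq_dom //= big_seq_cond big1 ?addr0 ?degU //.
  move=> z /andP[/ymax zy /eqP[]]; apply: val_inj; rewrite /= yE.
  by apply/eqP; rewrite -leeNy_eq -yE.
Qed.

(** The difference of two rays is a half-open interval. The geometry thus only has to identify [X]
    with the set of indicator functions of such intervals. *)
Lemma interval_iso (X : set (Defs.Hom (free_group S) int)) :
  (forall c, X c <-> exists y y' : ext Y, (\val y' < \val y)%O /\ forall t,
    c << t >> = `[<A t /\ (\val y' < (sigma t)%:E <= \val y)%E>]%:R) ->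
  exists psi : Defs.Hom (free_group S) int -> free_group (ext Y),
    zmod_iso (zspan X) (root_lattice (ext Y)) psi /\
    set_bij X (positive_roots (ext Y)) psi.
Proof.
move=> HX; rewrite root_lattice_positive.
suff -> : X = ray_hom @` positive_roots (ext Y) by exact: zmod_iso_section ray_hom_inj.
have rE (y y' : ext Y) : (\val y' < \val y)%O -> forall t,
    ray_hom (<< y >> - << y' >>) << t >> =
    `[<A t /\ (\val y' < (sigma t)%:E <= \val y)%E>]%:R.
  move=> yy t; rewrite free_homU raddfB.
  rewrite [X in X - _](free_homU (ray t)) [X in _ - X](free_homU (ray t)) /ray.
  have [At|nAt] := pselect (A t); last by rewrite !asboolF ?subrr // => -[].
  have AE (P : Prop) : (A t /\ P) = P by rewrite propeqE; split=> // -[].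
  rewrite !AE !asboolb.
  have [ty|ty] := leP ((sigma t)%:E) (\val y'); last first.
    by rewrite subr0 andTb.
  by rewrite (le_trans ty (ltW yy)) subrr.
apply/seteqP; split=> c.
  move=> /HX[y [y' [yy cE]]]; exists (<< y >> - << y' >>); first by exists y, y'.
  by apply: hom_ext => t; rewrite rE.
by move=> [_ [y [y' [yy ->]]] <-]; apply/HX; exists y, y'; split=> // t; rewrite rE.
Qed.

End Intervals.

(** * Supports of dimension vectors are intervals of the trace *)

Lemma set_type_val (U : Type) (A : set U) x : A x -> exists a : A, \val a = x.
Proof. by move=> Ax; exists (SigSub (mem_set Ax)). Qed.

Section Cuts.
Variables (R : realType) (Z : set (R * R)) (T : set (set (R * R))) (e f : R).
Local Notation point := (R * R)%type.
Local Notation cis := (@cis R).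
Local Notation frame := (frame Z T).
Local Notation Y := (trace T (cis e) (cis f)).
Local Notation param := (crossing_param e f).
Implicit Types (a b c d p q v w x y : R) (t : T).

Hypothesis hZ : Z `<=` circle R.
Hypothesis hZdiscrete : forall z, Z z -> ~ limit_point Z z.
Hypothesis hZlimit : forall y : point, limit_point Z y -> two_sided_limit Z y.
Hypothesis hT : triangulation Z T.
Hypotheses (ef : e < f) (fe : f < e + 2 * pi).
Hypotheses (cle : closure Z (cis e)) (clf : closure Z (cis f)).
Hypothesis nTef : ~ T [set cis e; cis f].

Let Tdiag : T `<=` Defs.diagonal Z. Proof. by case: hT. Qed.
Let Tnc : noncrossing T. Proof. by case: hT. Qed.
Let frame_nc := @frame_noncrossing R Z T Tnc.

(** Diagonals crossing [{e, f}] are handled through these pairs of angles; by [crossesP] and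
    [interlaced_inj] each of them has exactly one. *)
Definition cut x y := interlaced e f x y /\ T [set cis x; cis y].

Lemma cut_frame x y : cut x y -> frame x y.
Proof. by move=> [_ /(T_frame Tdiag)]. Qed.

Lemma frame_cut x y : interlaced e f x y -> frame x y -> cut x y.
Proof.
move=> xy Fxy; split=> //; case: xy => ex xf fy ye.
apply: (frame_separates hZ xf fy ye _ clf _ Fxy); first lra.
by rewrite cis_periodic.
Qed.

Lemma crossesP t : crosses (cis e) (cis f) (\val t) <->
  exists x y, cut x y /\ \val t = [set cis x; cis y].
Proof.
split=> [h|[x [y [[[ex xf fy ye] _] ->]]]]; last exact: crossesI.
have [|x [y [hx hy tE]]] := crosses_between _ h; first by rewrite ef.
exists x, y; rewrite -tE; split=> //; split; first by split; lra.
by rewrite -tE; exact: set_valP.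
Qed.

Lemma interlaced_inj x y x' y' : interlaced e f x y -> interlaced e f x' y' ->
  [set cis x; cis y] = [set cis x'; cis y'] -> x = x' /\ y = y'.
Proof.
move=> [ex xf fy ye] [ex' xf' fy' ye'] E.
case: (set2_inj E) => -[/cis_eq h /cis_eq h'].
  by split; [apply: h|apply: h']; lra.
by have := h ltac:(lra); lra.
Qed.

(** Two cuts that are not nested would cross. Nesting is therefore a total order, and by [param_leP]
    it is the order of the crossing points. *)
Lemma cut_total x y x' y' : cut x y -> cut x' y' ->
  (x <= x' /\ y' <= y) \/ (x' <= x /\ y <= y').
Proof.
move=> xy xy'; have Fxy := cut_frame xy; have Fxy' := cut_frame xy'.
case: xy xy' => -[ex xf fy ye] _ [[ex' xf' fy' ye'] _].
case: (leP x x') => xx; case: (leP y y') => yy; try (by left); try by right.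
- have [->|ne] := eqVneq x x'; first by right.
  have [->|ne'] := eqVneq y y'; first by left.
  by exfalso; apply: (@frame_nc x x' y y') => //; lra.
- by left; split=> //; exact: ltW.
- by right; split=> //; exact: ltW.
- by exfalso; apply: (@frame_nc x' x y' y) => //; lra.
Qed.

Lemma param_leP x y x' y' : cut x y -> cut x' y' ->
  param x y <= param x' y' <-> x <= x' /\ y' <= y.
Proof.
move=> xy xy'; split=> [|[xx yy]].
  have [//|[xx yy]] := cut_total xy xy'.
  have [[-> ->]|ne] := pselect ((x', y') = (x, y)); first by [].
  by have := crossing_param_lt xy.1 xy'.1 xx yy ne; rewrite ltNge => /negP.
have [[-> ->] //|ne] := pselect ((x, y) = (x', y')).
exact: ltW (crossing_param_lt xy'.1 xy.1 xx yy ne).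
Qed.

Lemma param_ltP x y x' y' : cut x y -> cut x' y' ->
  param x y < param x' y' <-> [/\ x <= x', y' <= y & (x, y) <> (x', y')].
Proof.
move=> xy xy'; split=> [lt_p|[xx yy ne]]; last exact: (crossing_param_lt xy'.1 xy.1).
have [xx yy] := (param_leP xy xy').1 (ltW lt_p).
by split=> // -[xE yE]; move: lt_p; rewrite xE yE ltxx.
Qed.

Lemma cut_trace x y : cut x y -> Y (param x y).
Proof. by move=> [xy Txy]; exact: trace_crossing. Qed.

Lemma trace_cut s : Y s -> exists x y, cut x y /\ s = param x y.
Proof.
move=> Ys; have [|x [y [xy Txy sE]]] := crossing_trace ef fe _ nTef Ys.
  move=> p q /Tdiag[z1 [z2 [[Z1 Z2] z12 _ _ E]]].
  by case: (set2_inj E) => -[-> ->]; split; do [exact: hZ|by []|exact: nesym].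
by exists x, y.
Qed.

(* The interval of the trace above [l] begins with the diagonal [{x, y}]. *)
Definition begins (l : \bar R) x y :=
  forall p q, cut p q -> (l < (param p q)%:E)%E <-> x <= p /\ q <= y.

(** A diagonal separating [a] from [b] cannot cross the sides [{a, x}] and [{a, y}] of the triangle
    with apex [a], so it passes beyond the third side. *)
Lemma apex_bound a b x y p q : a < x -> x < b -> b < y -> y < a + 2 * pi ->
  frame a x -> frame a y -> a < p -> p < b -> b < q -> q < a + 2 * pi ->
  frame p q -> x <= p /\ q <= y.
Proof.
move=> ax xb yb ya Fax Fay ap pb bq qa Fpq; split; rewrite leNgt; apply/negP => h.
  by apply: (@frame_nc a p x q) => //; lra.
by apply: (@frame_nc a p y q) => //; lra.
Qed.

(** Behind the cut [{x, y}] lies a triangle with apex [z]; the next cut is the side that still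
    separates [e] from [f]. At [z = f] there is no such side, and the statement says that no cut
    follows. *)
Lemma triangle_begins x z y : cut x y -> x < z -> z < y -> frame x z -> frame z y ->
  (z <= f -> begins (param x y)%:E z y) /\ (f <= z -> begins (param x y)%:E x z).
Proof.
move=> xy xz zy Fxz Fzy; case: (xy) => -[ex xf fy ye] _.
split=> zf p q pq; rewrite lte_fin; split.
- move=> /(param_ltP xy pq)[xp qy ne]; split=> //; rewrite leNgt; apply/negP => pz.
  have Fpq := cut_frame pq; case: (pq) => -[ep pf fq qe] _.
  case: (ltgtP x p) xp => // [xp|xpE] _.
    by apply: (@frame_nc x p z q) => //; lra.
  case: (ltgtP q y) qy => // [qy|qyE] _; last by apply: ne; rewrite xpE qyE.
  by apply: (@frame_nc z q y (p + 2 * pi)) => //; try lra; apply/frameDr/frameC.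
- move=> [zp qy]; apply/(param_ltP xy pq); split=> //; first lra.
  by move=> [xE _]; lra.
- move=> /(param_ltP xy pq)[xp qy ne]; split=> //; rewrite leNgt; apply/negP => zq.
  have Fpq := cut_frame pq; case: (pq) => -[ep pf fq qe] _.
  case: (ltgtP q y) qy => // [qy|qyE] _.
    by apply: (@frame_nc z q y (p + 2 * pi)) => //; try lra; apply/frameDr/frameC.
  case: (ltgtP x p) xp => // [xp|xpE] _; last by apply: ne; rewrite xpE qyE.
  by apply: (@frame_nc x p z q) => //; lra.
- move=> [xp qz]; apply/(param_ltP xy pq); split=> //; first lra.
  by move=> [_ yE]; lra.
Qed.

(* [apex x y a]: the triangle of [T] over [{x, y}] on the side of [e] has apex [a]. *)
Definition apex x y a := [/\ y - 2 * pi < a < x, frame a x & frame a y].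

(** The position of the apex relative to [e] selects the preceding cut: [{x, a}] if [a] lies before
    [e], [{a, y}] if after. If the apex is [e], then [{x, y}] is the first cut, and the lower end is
    [-oo]. *)
Lemma apex_begins x y a : cut x y -> apex x y a ->
  exists l : ext Y, begins (\val l) x y.
Proof.
move=> xy [/andP[ya ax] Fax Fay]; case: (xy) => -[ex xf fy ye] _.
case: (ltgtP a e) => [ae|ea|aE].
- have cxa : cut x (a + 2 * pi).
    apply: frame_cut; last by apply/frameDr/frameC.
    by split; lra.
  have Yl : ext Y (param x (a + 2 * pi))%:E.
    by left; exists (param x (a + 2 * pi)) => //; exact: cut_trace.
  have [l lE] := set_type_val Yl; exists l; rewrite lE.
  apply: (triangle_begins cxa _ _ _ _).2; try lra.
    exact: cut_frame.
  by apply/frameDr/frameC.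
- have cay : cut a y by apply: frame_cut => //; split; lra.
  have Yl : ext Y (param a y)%:E.
    by left; exists (param a y) => //; exact: cut_trace.
  have [l lE] := set_type_val Yl; exists l; rewrite lE.
  apply: (triangle_begins cay _ _ _ _).1 => //; try lra.
  exact: cut_frame.
have first p q : cut p q -> x <= p /\ q <= y.
  move=> pq; have Fpq := cut_frame pq; case: pq => -[ep pf fq qe] _.
  by apply: (@apex_bound a f) => //; lra.
have Yl : ext Y -oo%E.
  right; split=> //; exists (param x y); first exact: cut_trace.
  by move=> s /trace_cut[p [q [pq ->]]]; apply/param_leP => //; exact: first.
have [l lE] := set_type_val Yl; exists l; rewrite lE => p q pq /=.
by split=> [_|_]; [exact: first|exact: ltNyr].
Qed.

(** If [l] is the parameter of a cut, the triangle behind that cut, on the side of [f], supplies the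
    next one. If [l] is [-oo], the least cut is taken, with the triangle in front of it. *)
Lemma begins_apex (l : ext Y) x' y' : cut x' y' -> (\val l < (param x' y')%:E)%E ->
  exists x y a, [/\ cut x y, apex x y a, begins (\val l) x y & x <= x' /\ y' <= y].
Proof.
move=> xy' lt_l.
suff [x [y [a [xy ap bl]]]] :
    exists x y a, [/\ cut x y, apex x y a & begins (\val l) x y].
  by exists x, y, a; split=> //; exact/bl.
case: l lt_l => l /= /set_mem[[s /trace_cut[x [y [xy ->]]] <-]|
  [-> [m /trace_cut[x [y [xy ->]]] lb]]] lt_l.
  rewrite lte_fin in lt_l.
  have Fxy := cut_frame xy; case: (xy) => -[ex xf fy ye] Txy.
  have [|m hm Zm] := T_between hT _ Txy; first lra.
  have [|||z [xz zy Fxz Fzy]] :=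
    frame_triangle hZ hZdiscrete hZlimit hT _ _ _ Zm Fxy; try lra.
  have [b1 b2] := triangle_begins xy xz zy Fxz Fzy.
  case: (ltgtP z f) => [zf|fz|zE].
  - exists z, y, x; split; last by apply: b1; lra.
      by apply: frame_cut => //; split; lra.
    by split=> //; lra.
  - exists x, z, (y - 2 * pi); split; last by apply: b2; lra.
      by apply: frame_cut => //; split; lra.
    by split; [lra|exact/frameBl/frameC|exact/frameBl/frameC].
  (* An apex at [f] would make [{x, y}] the last cut, although [{x', y'}] comes later. *)
  - have [] := (b1 _ _ _ xy').1 lt_l; first lra.
    by case: xy' => -[]; lra.
have {lt_l} Fxy := cut_frame xy; case: (xy) => -[ex xf fy ye] Txy.
have [||m' hm Zm] := @T_between _ _ _ hT y (x + 2 * pi); first lra.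
  by rewrite cis_periodic setUC.
have [||||z [xz zy Fxz Fzy]] :=
  @frame_triangle _ _ _ hZ hZdiscrete hZlimit hT y (x + 2 * pi) m' _ _ _ Zm; try lra.
  by apply/frameDr/frameC.
exists x, y, (z - 2 * pi); split=> //.
  split; [lra| |exact/frameBl/frameC].
  by apply/frameBl; apply/frameDr.
move=> p q pq; split=> _; last exact: ltNyr.
by apply/(param_leP xy pq)/lb/cut_trace.
Qed.

(** The default 0 is taken on diagonals that do not cross [{e, f}]; there the crossing condition is
    false and the value has no influence. *)
Definition sigma t : R :=
  xget 0 [set s | exists x y, [/\ cut x y, \val t = [set cis x; cis y] & s = param x y]].

Lemma sigmaE t x y : cut x y -> \val t = [set cis x; cis y] -> sigma t = param x y.
Proof.
move=> xy tE; rewrite /sigma.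
case: xgetP => [_ _ [x' [y' [xy' tE' ->]]]|/(_ (param x y))[]].
  by have [-> ->] := interlaced_inj xy'.1 xy.1 (etrans (esym tE') tE).
by exists x, y.
Qed.

(** Here [a] is the apex in front of the first cut and [b] the apex behind the last. A diagonal
    separating them clears the sides of both triangles, by [apex_bound] at [a] and at [b], so it is
    nested between the two cuts. *)
Lemma dim_vector_interval (l : \bar R) x y x' y' a b :
  cut x y -> apex x y a -> begins l x y -> x <= x' -> y' <= y ->
  cut x' y' -> x' < b < y' -> frame x' b -> frame b y' ->
  forall t, dim_vector T (cis a) (cis b) << t >> =
    `[<crosses (cis e) (cis f) (\val t) /\
       (l < (sigma t)%:E <= (param x' y')%:E)%E>]%:R.
Proof.
move=> xy [axy Fax Fay] bl xx yy xy' bxy Fxb Fby t; rewrite dim_vectorE.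
congr (nat_of_bool _)%:R; apply/asboolP/asboolP.
  case: (xy) (xy') => -[ex xf fy ye] _ [[ex' xf' fy' ye'] _].
  move=> /(crosses_between _)[|p [q [hp hq tE]]]; first lra.
  have Fpq : frame p q by apply: (T_frame Tdiag); rewrite -tE; exact: set_valP.
  have [xp qy] : x <= p /\ q <= y by apply: (@apex_bound a b) => //; lra.
  have [y'q px] : y' <= q /\ p + 2 * pi <= x' + 2 * pi.
    apply: (@apex_bound b (a + 2 * pi)) => //; try lra.
    - by apply/frameDr/frameC.
    - by apply/frameDr/frameC.
  have pq : cut p q by apply: frame_cut => //; split; lra.
  split; first by apply/crossesP; exists p, q.
  rewrite (sigmaE pq tE) lee_fin; apply/andP; split; first exact/bl.
  by apply/param_leP => //; lra.
move=> [/crossesP[p [q [pq tE]]]]; rewrite (sigmaE pq tE) lee_fin tE => /andP[].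
move=> /(bl _ _ pq)[xp qy] /(param_leP pq xy')[px yq].
by apply: crossesI; lra.
Qed.

(** The lifts [p], [q] are normalised with respect to [{a, b}]. Being nested with the cut [{x, y}],
    the pair has [e] and [f] on the same sides as that cut, so its lifts are normalised for [{e, f}]
    too. *)
Lemma cut_of_crossing a b x y p q : cut x y -> y - 2 * pi < a < x -> x < b < y ->
  a < p < b -> b < q < a + 2 * pi -> T [set cis p; cis q] ->
  crosses (cis e) (cis f) [set cis p; cis q] -> cut p q.
Proof.
move=> xy ha hb hp hq Tpq; have Fxy := cut_frame xy; have Fpq := T_frame Tdiag Tpq.
case: (xy) => -[ex xf fy ye] _ /(crosses_sides _)[|c [d [hc hd h]]]; first lra.
split=> //.
have nest : (p <= x /\ y <= q) \/ (x <= p /\ q <= y).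
  case: (leP p x) => px; case: (leP y q) => yq;
    try (by left); try by right; split=> //; exact: ltW.
    have [->|ne] := eqVneq p x; first by right; split=> //; exact: ltW.
    by exfalso; apply: (@frame_nc p x q y) => //; lra.
  have [->|ne] := eqVneq y q; first by right; split=> //; exact: ltW.
  by exfalso; apply: (@frame_nc x p y q) => //; lra.
case: h => -[/cis_eq ec /cis_eq fd].
  case: nest => nest.
    have ecE := ec ltac:(lra); have fdE := fd ltac:(lra).
    by split; lra.
  have fdE := fd ltac:(lra); have ecE := ec ltac:(lra).
  by split; lra.
case: nest => nest.
  by have := fd ltac:(lra); lra.
by have := ec ltac:(lra); lra.
Qed.

End Cuts.

Lemma circle_closed (R : realType) : closed (circle R).
Proof.
have -> : circle R = (fun p => p.1 ^+ 2 + p.2 ^+ 2) @^-1` [set 1] by [].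
apply: closed_comp => [p _|]; last exact: closed_eq.
by apply: cvgD; apply: cvgM; first [exact: cvg_fst|exact: cvg_snd].
Qed.

(** From left to right, the triangles at [a] and [b] through which [{a, b}] passes have as far sides
    the first and last cut of the support. Conversely, the apexes in front of the first and behind
    the last cut of an interval serve as [a] and [b]. *)
Lemma dim_vectors_belowP (R : realType) (Z : set (R * R)) (T : set (set (R * R)))
    (e f : R) (hZ : Z `<=` circle R)
    (hZdiscrete : forall z, Z z -> ~ limit_point Z z)
    (hZlimit : forall y : R * R, limit_point Z y -> two_sided_limit Z y)
    (hT : triangulation Z T) (ef : e < f) (fe : f < e + 2 * pi)
    (cle : closure Z (cis e)) (clf : closure Z (cis f))
    (nTef : ~ T [set cis e; cis f]) (c : K0split_dual T) :
  dim_vectors_below Z T (cis e) (cis f) c <->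
  exists y y' : ext (trace T (cis e) (cis f)), (\val y' < \val y)%O /\ forall t : T,
    c << t >> = `[<crosses (cis e) (cis f) (\val t) /\
                   (\val y' < (sigma e f t)%:E <= \val y)%E>]%:R.
Proof.
have [Tdiag Tnc _ _] := hT.
split.
  move=> [[[p [q [Zp Zq pq cE]]] c0] csupp].
  have [t0 ct0] : exists t, c << t >> != 0.
    apply: contrapT => N; apply: c0; apply: hom_ext => t /=.
    by apply: contrapT => /eqP ct; apply: N; exists t.
  have below t : c << t >> != 0 -> crosses (cis e) (cis f) (\val t).
    move=> /csupp; rewrite /supp /mkset dim_vectorE.
    by case: asboolP.
  have /(crossesP ef fe)[x [y [xy t0E]]] := below _ ct0.
  case: (xy) => -[ex xf fy ye] Txy.
  have : crosses p q (\val t0).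
    by move: ct0; rewrite cE dim_vectorE; case: asboolP.
  rewrite t0E => /(crosses_sides _)[|a [b [ha hb hab]]]; first lra.
  have {cE p q Zp Zq pq hab} [Za Zb cE] : [/\ Z (cis a), Z (cis b) &
      forall t, c << t >> = `[<crosses (cis a) (cis b) (\val t)>]%:R].
    case: hab Zp Zq cE => -[-> ->] Zp Zq ->; split=> // t; rewrite dim_vectorE //.
    by congr (nat_of_bool _)%:R; apply/asboolP/asboolP; exact: crossesC.
  (* An edge separating [a] from [b] is a diagonal in the support of [c], so by the support
     condition it crosses [{e, f}]. *)
  have cutI u v : a < u < b -> b < v < a + 2 * pi -> frame Z T u v -> cut T e f u v.
    move=> hu hv Fuv.
    have Tuv : T [set cis u; cis v].
      apply: (@frame_separates _ Z _ hZ u v b (a + 2 * pi)) => //; try lra.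
        exact: subset_closure.
      by rewrite cis_periodic; exact: subset_closure.
    apply: (cut_of_crossing hT xy ha hb hu hv Tuv).
    have [t tE] := set_type_val Tuv; rewrite -tE; apply: below.
    rewrite cE asboolT ?oner_eq0 // tE; apply: crossesI; lra.
  have [||||u [v [hu hv Fau Fav Fuv]]] :=
    crossed_triangle hZ hZdiscrete hZlimit hT _ _ _ _ Za Zb Txy; try lra.
  have Zb' : Z (cis (a + 2 * pi)) by rewrite cis_periodic.
  have Tyx : T [set cis y; cis (x + 2 * pi)] by rewrite cis_periodic setUC.
  have [||||v' [w [hv' hw Fbv Fbw Fvw]]] :=
    crossed_triangle hZ hZdiscrete hZlimit hT _ _ _ _ Zb Zb' Tyx; try lra.
  (* The triangle at [b] was found in the window starting at [b]; one turn back brings [w] between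
     [a] and [b]. *)
  pose u' := w - 2 * pi.
  have Fuv' : frame Z T u' v' by apply/frameBl/frameC.
  have uv := cutI _ _ hu hv Fuv.
  have uv' : cut T e f u' v' by apply: cutI => //; rewrite /u'; lra.
  have [uu vv] : u <= u' /\ v' <= v.
    by apply: (apex_bound hT (a := a) (b := b)) => //; rewrite /u'; lra.
  have apa : apex Z T u v a by split=> //; lra.
  have [l bl] := apex_begins hZ hT ef fe cle clf nTef uv apa.
  have [m mE] : exists m : ext (trace T (cis e) (cis f)),
      \val m = (crossing_param e f u' v')%:E.
    apply: set_type_val; left; exists (crossing_param e f u' v') => //.
    exact: cut_trace.
  exists m, l; rewrite mE; split; first exact/(bl _ _ uv').
  move=> t; rewrite -(dim_vector_interval hZ hT ef fe cle clf uv apa bl uu vv uv'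
    (b := b)) ?dim_vectorE ?cE //; first by rewrite /u'; lra.
  by apply/frameBl/frameC.
move=> [m [l [lm cE]]].
have [s Ys mE] : exists2 s, trace T (cis e) (cis f) s & \val m = s%:E.
  case: m lm {cE} => m /= /set_mem[[s Ys <-] _|[-> _]]; first by exists s.
  by rewrite ltNge leNye.
have [x' [y' [xy' sE]]] := trace_cut hZ hT ef fe nTef Ys.
rewrite mE sE in lm cE.
have [x [y [a [xy apa bl [xx yy]]]]] :=
  begins_apex hZ hZdiscrete hZlimit hT ef fe cle clf nTef xy' lm.
case: (xy) (xy') => -[ex xf fy ye] Txy [[ex' xf' fy' ye'] Txy'].
have [|k hk Zk] := T_between hT _ Txy'; first by lra.
have [|||b [xb yb Fxb Fby]] :=
  frame_triangle hZ hZdiscrete hZlimit hT _ _ _ Zk (T_frame Tdiag Txy'); try lra.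
have hb : x' < b < y' by rewrite xb.
have dE := dim_vector_interval hZ hT ef fe cle clf xy apa bl xx yy xy' hb Fxb Fby.
have -> : c = dim_vector T (cis a) (cis b).
  by apply: hom_ext => t; rewrite cE dE.
split; last first.
  move=> t; rewrite /supp /mkset dE dim_vectorE.
  by case: asboolP => // -[tef _] _; rewrite asboolT.
case: apa => hxa Fxa Fya; split.
  exists (cis a), (cis b); split=> //; [by case: Fxa|by case: Fxb|].
  by move=> /cis_eq; lra.
(* The vector is nonzero because its value on the first cut is 1. *)
move=> d0; have [t tE] := set_type_val Txy.
have := dim_vectorE T (cis a) (cis b) t; rewrite d0 asboolT //.
by rewrite tE; apply: crossesI; lra.
Qed.

Theorem theorem8p12 (R : realType) (Z : set (R * R)) (T : set (set (R * R)))
    (hZ : Z `<=` circle R)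
    (hZ4 : `I_4 #<= Z)
    (hZdiscrete : forall z, Z z -> ~ limit_point Z z)
    (hZlimit : forall y : R * R, limit_point Z y -> two_sided_limit Z y)
    (hT : triangulation Z T)
    (e f : R * R) (he : closure Z e) (hf : closure Z f) (hef : e <> f)
    (hX : dim_vectors_below Z T e f !=set0) :
  exists psi : K0split_dual T -> free_group (ext (trace T e f)),
    zmod_iso (K0split_dual_at Z T e f) (root_lattice (ext (trace T e f))) psi /\
    set_bij (dim_vectors_below Z T e f) (positive_roots (ext (trace T e f))) psi.
Proof.
have circ p : closure Z p -> circle R p.
  by move=> /(closure_subset hZ); rewrite -(closure_id _).1 //; exact: circle_closed.
have [x _ eE] := circle_lift 0 (circ _ he).
have [y hy fE] := circle_lift x (circ _ hf).
rewrite {}eE {}fE in he hf hef hX *.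
have xy : x < y.
  rewrite lt_neqAle; case/andP: hy => -> _; rewrite andbT.
  by apply/eqP => E; apply: hef; rewrite E.
have yx : y < x + 2 * pi by case/andP: hy.
(* If [{e, f}] were in [T], nothing in [T] would cross it, so every vector supported below it would
   be zero, against [hX]. *)
have nT : ~ T [set cis x; cis y].
  case: hX => d [[_ d0] dsupp] Txy; apply: d0; apply: hom_ext => t /=.
  apply: contrapT => /eqP /dsupp; rewrite /supp /mkset dim_vectorE.
  case: asboolP => // h _; have [_ Tnc _ _] := hT.
  by apply: (Tnc _ _ _ Txy _ h); exact: set_valP.
apply: (@interval_iso _ _ _ _ (fun t => crosses (cis x) (cis y) (\val t)) (sigma x y)).
  move=> s /(trace_cut hZ hT xy yx nT)[u [v [uv ->]]].
  have [t tE] := set_type_val uv.2.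
  by exists t; [apply/(crossesP xy yx); exists u, v|exact: sigmaE tE].
exact: dim_vectors_belowP.
Qed.
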